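(* For $m,n,s,t=0,1,2,\dots$ and $\beta>-1$, $$\int_{\mathbb R^2}w_{m,n}^{(\beta)}(z,\bar z|q)\,\overline{w_{s,t}^{(\beta)}(z,\bar z|q)}\;r^{2\beta}\,d\mu(r^2|q)\,\frac{d\theta}{2\pi}=\zeta_{m\wedge n}(|m-n|+\beta)\,\delta_{m,s}\,\delta_{n,t},\qquad z=re^{i\theta},$$ where $$d\mu(x|q)=\sum_{k=0}^\infty x\,(xq;q)_\infty\,\delta(x-q^k),\qquad \zeta_n(\alpha)=\frac{(q;q)_\infty\,q^{(\alpha+1)n}(q;q)_n}{(q^{\alpha+1};q)_\infty(q^{\alpha+1};q)_n}.$$
   Context: $0<q<1$; $(a;q)_n=\prod_{k=0}^{n-1}(1-aq^k)$ (also for $n=\infty$), $(a,b;q)_n=(a;q)_n(b;q)_n$. The little $q$-Laguerre (Wall) polynomials are $$p_n(x;q^\alpha|q)=\sum_{k=0}^n\frac{(q;q)_n\,q^{(k-n)(n+k-1)/2}(-x)^{n-k}}{(q;q)_k(q,q^{\alpha+1};q)_{n-k}}.$$ For $\beta>-1$, $w^{(\beta)}_{m,n}(z_1,z_2|q)=z_1^{m-n}p_n(z_1z_2;q^{\beta+m-n}|q)$ if $m\ge n$, and $w^{(\beta)}_{m,n}(z_1,z_2|q)=w^{(\beta)}_{n,m}(z_2,z_1|q)$ if $m<n$. $m\wedge n=\min\{m,n\}$. $\delta(x-q^k)$ is the unit point mass at $q^k$, so $\mu$ has mass $q^k(q^{k+1};q)_\infty$ at $q^k$. The integral of $F(z)$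 against $r^{2\beta}d\mu(r^2|q)\frac{d\theta}{2\pi}$ means $\int_0^\infty\frac1{2\pi}\int_0^{2\pi}F(\sqrt x\,e^{i\theta})\,d\theta\,x^\beta d\mu(x|q)$. *)

(* Defs.v *)
From HB Require Import structures.
From mathcomp Require Import all_boot all_order all_algebra.
From mathcomp Require Import all_classical all_reals all_analysis.
From mathcomp Require Import complex.
Set Implicit Arguments.
Unset Strict Implicit.
Unset Printing Implicit Defensive.
Import Order.TTheory GRing.Theory Num.Theory.
Import numFieldNormedType.Exports.
Local Open Scope classical_set_scope.
Local Open Scope ring_scope.
Local Open Scope complex_scope.

Section qPochhammer.
Context {R : realType}.
Implicit Types a q : R.

Definition qpoch a q (n : nat) : R := \prod_(k < n) (1 - a * q ^+ k).

Definition qpoch_inf a q : R := lim (qpoch a q n @[n --> \oo]).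

Lemma qpoch_inf_ge0 a q : 0 <= a <= 1 -> 0 < q < 1 -> 0 <= qpoch_inf a q.
Proof.
move=> /andP[a0 a1] /andP[q0 q1].
have fac k : 0 <= 1 - a * q ^+ k <= 1.
  rewrite subr_ge0 gerBl mulr_ge0 ?exprn_ge0 ?(ltW q0)// andbT.
  by rewrite mulr_ile1 ?exprn_ge0 ?exprn_ile1 ?(ltW q0) ?(ltW q1).
have ge0 n : 0 <= qpoch a q n.
  by apply: prodr_ge0 => k _; case/andP: (fac k).
apply: limr_ge; last by apply: nearW.
apply: nonincreasing_is_cvgn; last by exists 0 => _ [n _ <-].
apply/nonincreasing_seqP => n; rewrite /qpoch big_ord_recr /=.
by apply: ler_piMr; [exact: ge0|case/andP: (fac n)].
Qed.

End qPochhammer.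

Section Wall.
Context {R : realType}.
Implicit Types q alpha beta : R.

(* [wall q alpha n x] is p_n(x; q^alpha | q), with a complex argument x. *)
Definition wall q alpha (n : nat) (x : R[i]) : R[i] :=
  \sum_(k < n.+1)
    ((qpoch q q n * q `^ ((k%:R - n%:R) * (n%:R + k%:R - 1) / 2) /
      (qpoch q q k *
       (qpoch q q (n - k) * qpoch (q `^ (alpha + 1)) q (n - k))))%:C
     * (- x) ^+ (n - k)).

Definition wall2 q beta (m n : nat) (z1 z2 : R[i]) : R[i] :=
  if (n <= m)%N
  then z1 ^+ (m - n) * wall q (beta + m%:R - n%:R) n (z1 * z2)
  else z2 ^+ (n - m) * wall q (beta + n%:R - m%:R) m (z2 * z1).

Definition zeta q (n : nat) alpha : R :=
  qpoch_inf q q * q `^ ((alpha + 1) * n%:R) * qpoch q q n /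
  (qpoch_inf (q `^ (alpha + 1)) q * qpoch (q `^ (alpha + 1)) q n).

End Wall.

Section WallMeasure.
Context {R : realType} (q : R) (hq : 0 < q < 1).

Definition mu_weight (x : R) : R := x * qpoch_inf (x * q) q.

Lemma mu_weight_ge0 k : 0 <= mu_weight (q ^+ k).
Proof.
have /andP[q0 q1] := hq; apply: mulr_ge0; first by rewrite exprn_ge0 ?ltW.
apply: qpoch_inf_ge0 => //; rewrite -exprSr.
by rewrite exprn_ge0 ?exprn_ile1 ?(ltW q0) ?(ltW q1).
Qed.

Definition mu : {measure set R -> \bar R} :=
  mseries (fun k => mscale (NngNum (mu_weight_ge0 k)) (dirac (q ^+ k))) 0.

End WallMeasure.

Section ComplexIntegral.
Context {d : measure_display} {T : measurableType d} {R : realType}.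
Variables (nu : {measure set T -> \bar R}) (D : set T) (F : T -> R[i]).

Definition cintegrable : Prop :=
  nu.-integrable D (fun x => (complex.Re (F x))%:E) /\
  nu.-integrable D (fun x => (complex.Im (F x))%:E).

Definition cintegral : R[i] :=
  (\int[nu]_(x in D) complex.Re (F x)) +i* (\int[nu]_(x in D) complex.Im (F x)).

End ComplexIntegral.

Section PolarIntegral.
Context {R : realType} (q : R) (hq : 0 < q < 1) (beta : R).
Implicit Types (F : R[i] -> R[i]) (r x theta : R).

Definition polar r theta : R[i] := r%:C * (cos theta +i* sin theta).

Definition angular_mean F r : R[i] :=
  ((2 * pi)^-1)%:C *
  cintegral lebesgue_measure `[0, 2 * pi] (fun theta => F (polar r theta)).

Definition polar_integral F : R[i] :=
  cintegral (mu hq) `]0, +oo[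
    (fun x => angular_mean F (Num.sqrt x) * (x `^ beta)%:C).

(* [cintegral] has a default value on non-integrable functions; this says that
   no such value occurs in [polar_integral]. *)
Definition polar_integrable F : Prop :=
  (forall x, 0 < x ->
     cintegrable lebesgue_measure `[0, 2 * pi]
       (fun theta => F (polar (Num.sqrt x) theta))) /\
  cintegrable (mu hq) `]0, +oo[
    (fun x => angular_mean F (Num.sqrt x) * (x `^ beta)%:C).

End PolarIntegral.

(* Main.v *)
Require Import Defs.
From HB Require Import structures.
From mathcomp Require Import all_boot all_order all_algebra.
From mathcomp Require Import all_classical all_reals all_analysis.
From mathcomp Require Import complex.
From mathcomp Require Import measurable_realfun.
From mathcomp Require Import ring lra zify.
Set Implicit Arguments.
Unset Strict Implicit.
Unset Printing Implicit Defensive.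
Import Order.TTheory GRing.Theory Num.Theory.
Import numFieldNormedType.Exports.
Local Open Scope ring_scope.
Local Open Scope complex_scope.

(** The angular integral separates the frequencies. Writing z = r e^(i theta), the
    function w_(m,n) is e^(i (m - n) theta) times a real function of r
    ([wall2_polar]), so the mean over theta of the product vanishes unless
    m - n = s - t. In that case both radial parts contain r^|m - n|, and what is
    left is the integral of x^alpha p_k(x) p_l(x) against mu, with
    alpha = |m - n| + beta, k = min(m, n) and l = min(s, t): the orthogonality of
    the Wall polynomials with parameter q^alpha.

    That orthogonality has an analytic and an algebraic half. Put
    a = q^(alpha + 1) > 0. The measure x^alpha mu is carried by the points q^k, with
    masses (q;q)_oo a^k / (q;q)_k, so by Euler's identity
    sum_k u^k / (q;q)_k = 1 / (u;q)_oo its moment of order i is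
    (q;q)_oo (a;q)_i / (a;q)_oo ([cvg_qpoch], [cvg_moment], [integral_mu_powR_horner]).
    Euler's series f satisfies f(u q) = (1 - u) f(u), whence
    f(u q^n) = (u;q)_n f(u), and letting n tend to infinity gives both the
    convergence of the infinite product and its value.

    On the algebraic side, the functional x^i |-> (a;q)_i applied to x^j p_n cancels
    the denominators (a;q)_i of the coefficients of p_n and leaves the coefficients
    of the finite product (q^(1-n) x;q)_n, paired with a polynomial of degree j in
    q^i. Hence it is a combination of the values of that product at x = q^l for
    l <= j. They vanish for l < n, which gives orthogonality to lower degrees, and
    the single surviving term for j = n gives the norm ([momentXnM_wallp],
    [moment_wallpM]). *)

(** * Shifted factorials and the finite q-binomial theorem *)

Section Algebra.
Context {R : realType}.
Implicit Types (a q z : R) (p : {poly R}).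

Lemma qpoch0 a q : qpoch a q 0 = 1.
Proof. by rewrite /qpoch big_ord0. Qed.

Lemma qpochSr a q n : qpoch a q n.+1 = qpoch a q n * (1 - a * q ^+ n).
Proof. by rewrite /qpoch big_ord_recr. Qed.

Lemma qpochD a q m n : qpoch a q (m + n) = qpoch a q m * qpoch (a * q ^+ m) q n.
Proof.
elim: n => [|n IH]; first by rewrite addn0 qpoch0 mulr1.
by rewrite addnS !qpochSr IH -!mulrA -exprD.
Qed.

Lemma qpoch_gt0 a q n : 0 <= a < 1 -> 0 < q < 1 -> 0 < qpoch a q n.
Proof.
move=> /andP[a0 a1] /andP[q0 q1]; apply: prodr_gt0 => k _.
rewrite subr_gt0; apply: le_lt_trans a1; apply: ler_piMr => //.
by rewrite exprn_ile1 ?ltW.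
Qed.

(** The shifted factorial (ax;q)_n as a polynomial in x. *)
Definition qpochX a q (n : nat) : {poly R} := \prod_(k < n) (1 - (a * q ^+ k) *: 'X).

Lemma horner_qpochX a q n z : (qpochX a q n).[z] = qpoch (a * z) q n.
Proof.
rewrite /qpochX /qpoch horner_prod; apply: eq_bigr => k _.
by rewrite !hornerE mulrAC.
Qed.

Lemma qpochXSr a q n :
  qpochX a q n.+1 = qpochX a q n - (a * q ^+ n) *: (qpochX a q n * 'X).
Proof. by rewrite /qpochX big_ord_recr /= mulrBr mulr1 -scalerAr. Qed.

Lemma size_qpochX a q n : (size (qpochX a q n) <= n.+1)%N.
Proof.
elim: n => [|n IH]; first by rewrite /qpochX big_ord0 size_poly1.
rewrite qpochXSr (leq_trans (size_polyD _ _)) // geq_max (leqW IH) size_polyN.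
rewrite (leq_trans (size_scale_leq _ _))//.
by have [->|nz] := eqVneq (qpochX a q n) 0; rewrite ?mul0r ?size_poly0 // size_mulX.
Qed.

(** The finite q-binomial theorem of Gauss. The coefficients of the products of
    [n] and [n.+1] factors are related by the q-Pascal rule, which the quotient on
    the right satisfies as well. *)
Lemma coef_qpochX a q n i : 0 < q < 1 -> (i <= n)%N ->
  (qpochX a q n)`_i =
  (- a) ^+ i * q ^+ 'C(i, 2) * qpoch q q n / (qpoch q q i * qpoch q q (n - i)).
Proof.
move=> hq; have hq1 : 0 <= q < 1 by case/andP: hq => /ltW -> ->.
have nz k : qpoch q q k != 0 by rewrite gt_eqF ?qpoch_gt0.
elim: n i => [|n IH] i.
  by rewrite leqn0 => /eqP ->; rewrite /qpochX big_ord0 coef1 qpoch0 /= !mulr1 divr1.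
rewrite qpochXSr coefB coefZ coefMX.
case: i => [|i] hi.
  by rewrite /= mulr0 subr0 IH// !subn0 qpoch0 bin_small//; field; rewrite !nz.
rewrite ltnS in hi.
have nz1 k : 1 - q * q ^+ k != 0.
  by have := nz k.+1; rewrite qpochSr mulf_eq0 negb_or => /andP[].
rewrite /= (IH i)// subSS binS bin1 exprD exprSr (qpochSr q q n) (qpochSr q q i).
have [->|ne] := eqVneq i n.
  rewrite subnn qpoch0 nth_default ?size_qpochX//.
  by field; rewrite nz nz1.
have lt : (i < n)%N by rewrite ltn_neqAle ne.
rewrite (IH i.+1)// binS bin1 exprD exprSr (qpochSr q q i).
rewrite (_ : n - i = (n - i.+1).+1)%N; last by rewrite subnSK.
rewrite (qpochSr q q (n - i.+1)).
have -> : q ^+ n = q ^+ i * q * q ^+ (n - i.+1) by rewrite -exprSr -exprD subnKC.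
by field; rewrite !nz !nz1.
Qed.

(** The factor of index [n - l.+1] of this product is [1 - q ^+ 0] = 0. *)
Lemma qpoch_shift_eq0 q n l : q != 0 -> (l < n)%N -> qpoch (q / q ^+ n * q ^+ l) q n = 0.
Proof.
move=> q0 ln; have kn : (n - l.+1 < n)%N by rewrite ltn_subrL (leq_trans _ ln).
have e1 : q / q ^+ n * q ^+ l * q ^+ (n - l.+1) = 1.
  rewrite -mulrA -exprD mulrAC -exprS -addSn subnKC//.
  by rewrite divff// expf_neq0.
by rewrite -[X in qpoch _ _ X](subnKC kn) qpochD qpochSr e1 subrr mulr0 mul0r.
Qed.

(** * Moments and Wall polynomials *)

(** Up to the factor [qpoch_inf a q], the integral of [p] against the measure with
    mass [a ^+ k / qpoch q q k] at [q ^+ k]; see [cvg_moment]. *)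
Definition moment a q p : R := \sum_(i < size p) p`_i * qpoch a q i.

(** Summing past the degree allows polynomials of different degrees to be
    compared, which is how linearity is obtained. *)
Lemma momentE a q p n : (size p <= n)%N ->
  moment a q p = \sum_(i < n) p`_i * qpoch a q i.
Proof.
move=> pn; rewrite /moment (big_ord_widen n (fun i => p`_i * qpoch a q i) pn).
rewrite [RHS](bigID (fun i : 'I_n => i < size p)%N) /= [X in _ + X]big1 ?addr0//.
by move=> i; rewrite -leqNgt => /leq_sizeP -> //; rewrite mul0r.
Qed.

Fact moment_is_linear a q : linear (moment a q : {poly R} -> R^o).
Proof.
move=> c p1 p2; pose n := maxn (size p1) (size p2).
have s1 : (size p1 <= n)%N by rewrite leq_maxl.
have s2 : (size p2 <= n)%N by rewrite leq_maxr.
rewrite !(@momentE a q _ n)//; last first.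
  rewrite (leq_trans (size_polyD _ _)) // geq_max s2 andbT.
  exact: leq_trans (size_scale_leq _ _) s1.
rewrite scaler_sumr -big_split/=; apply: eq_bigr => i _.
by rewrite coefD coefZ mulrDl -mulrA.
Qed.

HB.instance Definition _ a q :=
  GRing.isLinear.Build R {poly R} R^o _ (moment a q) (moment_is_linear a q).

Lemma momentXn a q n : moment a q 'X^n = qpoch a q n.
Proof.
rewrite (@momentE _ _ _ n.+1) ?size_polyXn// big_ord_recr/= big1 ?add0r.
  by rewrite coefXn eqxx mul1r.
by move=> i _; rewrite coefXn ltn_eqF// mul0r.
Qed.

(** The polynomial p_n(x; q^alpha | q) with a = q^(alpha + 1). Without the
    denominators [qpoch a q i] its coefficients are those of the q-binomial
    theorem, so that sums of these coefficients against powers of q factor. *)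
Definition wallp a q n : {poly R} :=
  \poly_(i < n.+1) ((qpochX (q / q ^+ n) q n)`_i / qpoch a q i).

Section Orthogonality.
Variables (a q : R) (ha : 0 <= a < 1) (hq : 0 < q < 1).

Let q1 : 0 <= q < 1. Proof. by case/andP: hq => /ltW -> ->. Qed.
Let q0 : q != 0. Proof. by case/andP: hq => /lt0r_neq0. Qed.

Let qpocha_neq0 n : qpoch a q n != 0.
Proof. by rewrite gt_eqF ?qpoch_gt0. Qed.

Let qpochq_neq0 n : qpoch q q n != 0.
Proof. by rewrite gt_eqF ?qpoch_gt0. Qed.

(** The denominators of [wallp] cancel the moments, since (a;q)_(i+j) =
    (a;q)_i (a q^i;q)_j. What remains is the sum over i of the coefficients of
    the product [qpochX (q / q ^+ n) q n] times (a q^i;q)_j, a polynomial of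
    degree j in q^i. Expanding the latter and exchanging sums evaluates the
    former at each q^l. *)
Lemma momentXnM_wallp j n : moment a q ('X^j * wallp a q n) =
  \sum_(l < j.+1) (qpochX a q j)`_l * qpoch (q / q ^+ n * q ^+ l) q n.
Proof.
rewrite /wallp poly_def mulr_sumr linear_sum /=.
transitivity (\sum_(i < n.+1) (qpochX (q / q ^+ n) q n)`_i * (qpochX a q j).[q ^+ i]).
  apply: eq_bigr => i _; rewrite -scalerAr linearZ -exprD /= momentXn addnC qpochD.
  by rewrite horner_qpochX /GRing.scale/= -mulrA mulKf.
transitivity (\sum_(l < j.+1) (qpochX a q j)`_l * (qpochX (q / q ^+ n) q n).[q ^+ l]).
  under eq_bigr do rewrite (horner_coef_wide _ (size_qpochX _ _ _)) mulr_sumr.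
  rewrite exchange_big /=; apply: eq_bigr => l _.
  rewrite (horner_coef_wide _ (size_qpochX _ _ _)) mulr_sumr.
  by apply: eq_bigr => i _; rewrite mulrCA -!exprM mulnC.
by apply: eq_bigr => l _; rewrite horner_qpochX.
Qed.

(** All degrees [l <= j < n] occurring in [qpochX a q j] are annihilated by
    [qpoch_shift_eq0]. *)
Lemma momentXnM_wallp_eq0 j n : (j < n)%N -> moment a q ('X^j * wallp a q n) = 0.
Proof.
move=> jn; rewrite momentXnM_wallp big1// => l _.
by rewrite qpoch_shift_eq0 ?mulr0// (leq_trans _ jn).
Qed.

(** For [j = n] only the leading coefficient of [qpochX a q n] survives, and
    the remaining product is [qpoch q q n]. *)
Lemma momentXnM_wallpn n :
  moment a q ('X^n * wallp a q n) = (- a) ^+ n * q ^+ 'C(n, 2) * qpoch q q n.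
Proof.
rewrite momentXnM_wallp big_ord_recr /= big1 ?add0r => [|l _].
  by rewrite coef_qpochX// subnn qpoch0 mulr1 mulfK// mulfVK ?expf_neq0.
by rewrite qpoch_shift_eq0 ?mulr0.
Qed.

(** The polynomial of smaller degree is expanded in powers of x, all of which
    but possibly the leading one are orthogonal to the other polynomial. *)
Lemma moment_wallpM t n : moment a q (wallp a q t * wallp a q n) =
  (t == n)%:R * (a ^+ t * qpoch q q t / qpoch a q t).
Proof.
wlog tn : t n / (t <= n)%N => [hw|].
  have [|nt] := leqP t n; first exact: hw.
  rewrite mulrC hw 1?ltnW// eq_sym.
  by have [->//|] := eqVneq t n; rewrite !mul0r.
rewrite {1}/wallp poly_def mulr_suml linear_sum /= big_ord_recr/= big1 ?add0r => [|j _]; last first.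
  by rewrite -scalerAl linearZ/= momentXnM_wallp_eq0 ?scaler0// (leq_trans (ltn_ord j)).
rewrite -scalerAl linearZ/=.
have [->|ne] := eqVneq t n; last first.
  by rewrite momentXnM_wallp_eq0 ?scaler0 ?mul0r// ltn_neqAle ne.
rewrite momentXnM_wallpn mul1r coef_qpochX// subnn qpoch0 /GRing.scale/=.
(* All powers of q cancel because n + 2 binom(n, 2) = n^2. *)
have eq2 : q ^+ n * (q ^+ 'C(n, 2) * q ^+ 'C(n, 2)) = q ^+ n ^+ n.
  rewrite -exprM -!exprD addnn -mul2n -mul_bin_diag bin1.
  by case: (n) => [//|k]; rewrite -[X in (X + _)%N]muln1 -mulnDr.
rewrite (exprNn a) (exprNn (q / _)) exprMn exprVn.
have sgn : (-1) ^+ n * (-1) ^+ n = 1 :> R by rewrite -exprMn mulrNN mulr1 expr1n.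
have := qpocha_neq0 n; have := qpochq_neq0 n.
have : q ^+ n ^+ n != 0 by rewrite !expf_neq0.
rewrite -eq2; set C := q ^+ 'C(n, 2); set S := (-1) ^+ n in sgn *.
move=> nz nq na.
transitivity (S * S * (a ^+ n * qpoch q q n / qpoch a q n)); last by rewrite sgn mul1r.
have [q_n C_n] : q ^+ n != 0 /\ C != 0 by rewrite !expf_neq0.
by field; rewrite na nq C_n q_n.
Qed.

End Orthogonality.

End Algebra.

Lemma powR_lt1 (R : realType) (q r : R) : 0 < q < 1 -> 0 < r -> 0 <= q `^ r < 1.
Proof.
move=> /andP[q0 q1] r0; rewrite powR_ge0/= /powR gt_eqF// -expR0 ltr_expR.
by rewrite pmulr_rlt0// ln_lt0// q0.
Qed.

(** Reversing the sum, the term of degree j carries the exponent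
    j + binom(j, 2) - n j of q, as in [coef_qpochX] with a = q^(1 - n). *)
Lemma wallE (R : realType) (q alpha x : R) n : 0 < q < 1 -> -1 < alpha ->
  wall q alpha n x%:C = ((wallp (q `^ (alpha + 1)) q n).[x])%:C.
Proof.
move=> hq halpha; have /andP[q0 q1] := hq.
rewrite /wall /wallp horner_poly rmorph_sum (reindex_inj rev_ord_inj) /=.
apply: eq_bigr => j _; rewrite subSS.
have jn : (j <= n)%N by rewrite -ltnS.
rewrite subKn// coef_qpochX// -rmorphN -rmorphXn -rmorphM/=; congr (_%:C).
have -> : ((n - j)%:R - n%:R) * (n%:R + (n - j)%:R - 1) / 2 =
   (j + 'C(j, 2))%:R - (n * j)%:R :> R.
  have : (2 * 'C(j, 2))%:R = j%:R * (j%:R - 1) :> R.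
    rewrite -mul_bin_diag bin1 natrM; case: (j : nat) => [|i]; first by rewrite !mul0r.
    by rewrite /= -natr1 addrK.
  rewrite natrB// natrD !natrM => eq2.
  by have -> : 'C(j, 2)%:R = j%:R * (j%:R - 1) / 2 :> R; [rewrite -eq2|]; field.
rewrite powRB ?powR_mulrn ?(ltW q0)//; last by rewrite (gt_eqF q0) implybT.
rewrite exprD (exprNn (q / _)) !exprMn exprVn (exprNn x) -exprM.
have nz k : qpoch q q k != 0 by rewrite gt_eqF ?qpoch_gt0// ltW.
have a1 : q `^ (alpha + 1) < 1.
  by have /andP[] : 0 <= q `^ (alpha + 1) < 1 by apply: powR_lt1; rewrite// -ltrBlDr sub0r.
have na : qpoch (q `^ (alpha + 1)) q j != 0 by rewrite gt_eqF ?qpoch_gt0 ?powR_ge0//.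
have nq : q ^+ (n * j) != 0 by rewrite expf_neq0 ?gt_eqF.
by field; rewrite na nq !nz.
Qed.

(** * Euler's series *)

Section Euler.
Local Open Scope classical_set_scope.
Variables (R : realType) (q : R) (hq : 0 < q < 1).
Implicit Types (u v : R) (n k : nat) (p : {poly R}).

Let q0 : 0 < q. Proof. by case/andP: hq. Qed.
Let q1 : q < 1. Proof. by case/andP: hq. Qed.
Let qq : 0 <= q < 1. Proof. by rewrite q1 ltW. Qed.

Definition euler_term u k : R := u ^+ k / qpoch q q k.

Let qpoch_pos k : 0 < qpoch q q k. Proof. exact: qpoch_gt0. Qed.

Lemma euler_term_ge0 u k : 0 <= u -> 0 <= euler_term u k.
Proof. by move=> u0; rewrite divr_ge0 ?exprn_ge0// ltW. Qed.

(** Summation of (1 - q^k) u^k / (q;q)_k = u u^(k-1) / (q;q)_(k-1). *)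
Lemma euler_rec u n : u * series (euler_term u) n =
  series (euler_term u) n.+1 - series (euler_term (u * q)) n.+1.
Proof.
elim: n => [|n IH].
  by rewrite !seriesSr /series/= !big_geq// mulr0 /euler_term !expr0 subrr.
rewrite [LHS](_ : _ = u * (series (euler_term u) n + euler_term u n)); last first.
  by rewrite seriesSr.
rewrite mulrDr IH [in RHS]seriesSr [X in _ = _ - X]seriesSr opprD addrACA; congr (_ + _).
rewrite /euler_term exprMn.
have := qpoch_pos n.+1; rewrite qpochSr => /gt_eqF/negbT; rewrite mulf_eq0 negb_or.
by move=> /andP[nz nz']; rewrite !exprS; field; rewrite nz nz'.
Qed.

(** Each factor of (q;q)_k is at least 1 - q, so the terms are dominated by
    2^-k. *)
Lemma cvg_euler_small u : 0 <= u <= (1 - q) / 2 -> cvgn (series (euler_term u)).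
Proof.
move=> /andP[u0 uq].
apply: (@series_le_cvg _ _ (geometric 1 2^-1)).
- by move=> k; exact: euler_term_ge0.
- by move=> k; rewrite geometric_ge0// invr_ge0.
- move=> k; rewrite /euler_term /= mul1r ler_pdivrMr//.
  elim: k => [|k IH]; first by rewrite !expr0 qpoch0 mulr1.
  rewrite !exprSr qpochSr [leRHS]mulrACA ler_pM ?exprn_ge0//.
  apply: (le_trans uq); rewrite mulrC ler_wpM2l ?invr_ge0// lerD2l lerN2.
  by rewrite ler_piMr ?(ltW q0)// exprn_ile1 ?ltW.
- by apply: is_cvg_geometric_series; rewrite ger0_norm ?invr_ge0// invf_lt1// ltr1n.
Qed.

(** By [euler_rec], 1 - u times a partial sum at u is at most a partial sum at
    u q, so bounds propagate from u q to u. *)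
Lemma cvg_euler_step u : 0 <= u < 1 ->
  cvgn (series (euler_term (u * q))) -> cvgn (series (euler_term u)).
Proof.
move=> /andP[u0 u1] cq; apply: nondecreasing_is_cvgn.
  by apply: nondecreasing_series => k _ _; exact: euler_term_ge0.
exists (limn (series (euler_term (u * q))) / (1 - u)) => _ [n _ <-].
rewrite ler_pdivlMr ?subr_gt0// mulrBr mulr1 mulrC euler_rec seriesSr.
have h : series (euler_term (u * q)) n.+1 <= limn (series (euler_term (u * q))).
  apply: nondecreasing_cvgn_le => //.
  by apply: nondecreasing_series => k _ _; rewrite euler_term_ge0// mulr_ge0// ltW.
have := euler_term_ge0 n u0; lra.
Qed.

Lemma mulq_lt1 u k : 0 <= u < 1 -> 0 <= u * q ^+ k < 1.
Proof.
move=> /andP[u0 u1]; rewrite mulr_ge0 ?exprn_ge0 ?(ltW q0)//=.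
by apply: le_lt_trans u1; rewrite ler_piMr// exprn_ile1 ?ltW.
Qed.

(** Some u q^M is small enough for [cvg_euler_small]; [cvg_euler_step] then
    climbs back from u q^M to u. *)
Lemma is_cvg_euler u : 0 <= u < 1 -> cvgn (series (euler_term u)).
Proof.
move=> hu; have /andP[u0 u1] := hu.
have [M hM] : exists M, u * q ^+ M <= (1 - q) / 2.
  have : u * q ^+ n @[n --> \oo] --> 0.
    by apply: cvg_geometric; rewrite ger0_norm ?ltW.
  move/cvgr0Pnorm_le => /(_ ((1 - q) / 2)).
  rewrite divr_gt0 ?subr_gt0// => /(_ isT) [M _ /(_ M (leqnn _))] /= le_u.
  by exists M; apply: le_trans le_u; exact: ler_norm.
elim: M u hu u0 u1 hM => [|M IH] u hu u0 u1.
  by rewrite expr0 mulr1 => h; apply: cvg_euler_small; rewrite u0.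
rewrite exprS mulrA => h; apply: cvg_euler_step => //.
have hu' := mulq_lt1 1 hu; rewrite expr1 in hu'.
by apply: IH => //; case/andP: hu'.
Qed.

Definition euler_series u : R := limn (series (euler_term u)).

Lemma euler_mulq u : 0 <= u < 1 -> euler_series (u * q) = (1 - u) * euler_series u.
Proof.
move=> hu; have hq' := mulq_lt1 1 hu; rewrite expr1 in hq'.
have c1 := is_cvg_euler hu; have c2 := is_cvg_euler hq'.
have e : u * euler_series u = euler_series u - euler_series (u * q).
  have l1 : (fun n => u * series (euler_term u) n) @ \oo --> u * euler_series u.
    exact: cvgMr.
  have l2 : (fun n => u * series (euler_term u) n) @ \oo --> euler_series u - euler_series (u * q).
    under eq_fun do rewrite euler_rec.
    have := cvgB c1 c2; rewrite -(cvg_shiftS (_ - _)).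
    exact.
  exact: cvg_unique l1 l2.
by rewrite mulrBl mul1r e opprB addrCA subrr addr0.
Qed.

Lemma euler_mulqX u n : 0 <= u < 1 -> euler_series (u * q ^+ n) = qpoch u q n * euler_series u.
Proof.
move=> hu; elim: n => [|n IH]; first by rewrite expr0 mulr1 qpoch0 mul1r.
by rewrite exprSr mulrA euler_mulq ?mulq_lt1// IH qpochSr; ring.
Qed.

Lemma euler_ge1 u : 0 <= u < 1 -> 1 <= euler_series u.
Proof.
move=> hu; have /andP[u0 _] := hu.
have S1 : series (euler_term u) 1 = 1.
  by rewrite seriesSr /series/= big_geq// add0r /euler_term expr0 qpoch0 divr1.
rewrite -[leLHS]S1; apply: nondecreasing_cvgn_le; last exact: is_cvg_euler.
by apply: nondecreasing_series => k _ _; exact: euler_term_ge0.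
Qed.

(** Termwise: for k > 0, (u q^n)^k <= q^n u^k. This gives the continuity at 0
    of Euler's series that [cvg_qpoch] needs. *)
Lemma euler_le u n : 0 <= u < 1 -> euler_series (u * q ^+ n) <= 1 + q ^+ n * euler_series u.
Proof.
move=> hu; have /andP[u0 _] := hu; have hn := mulq_lt1 n hu; have /andP[un0 _] := hn.
have qn0 : 0 <= q ^+ n by rewrite exprn_ge0 ?ltW.
have key m : series (euler_term (u * q ^+ n)) m <= 1 + q ^+ n * series (euler_term u) m.
  elim: m => [|m IH].
    by rewrite /series/= !big_geq// mulr0 addr0.
  rewrite !seriesSr.
  case: m IH => [_|m IH].
    rewrite /series/= !big_geq// !add0r /euler_term !expr0 qpoch0 invr1 !mulr1.
    by rewrite lerDl.
  rewrite mulrDr addrA lerD// /euler_term mulrA ler_wpM2r ?invr_ge0 ?(ltW (qpoch_pos _))//.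
  rewrite exprMn mulrC ler_wpM2r ?exprn_ge0//.
  by rewrite exprS -[leRHS]mulr1 ler_wpM2l// exprn_ile1// exprn_ile1// ltW.
apply: limr_le; first exact: is_cvg_euler.
near=> m.
apply: (@le_trans _ _ (1 + q ^+ n * series (euler_term u) m)); last first.
  rewrite lerD2l ler_wpM2l//; apply: nondecreasing_cvgn_le; last exact: is_cvg_euler.
  by apply: nondecreasing_series => k _ _; exact: euler_term_ge0.
exact: key.
Unshelve. all: by end_near. Qed.

(** Euler's identity. By [euler_mulqX] the n-th product is the ratio of Euler's
    series at u q^n and at u, and the numerator tends to its value 1 at 0. *)
Lemma cvg_qpoch u : 0 <= u < 1 -> qpoch u q n @[n --> \oo] --> (euler_series u)^-1.
Proof.
move=> hu; have e1 := euler_ge1 hu.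
have e0 : euler_series u != 0 by rewrite gt_eqF// (lt_le_trans _ e1).
have -> : qpoch u q = (fun n => euler_series (u * q ^+ n) * (euler_series u)^-1).
  by apply/funext => n; rewrite euler_mulqX// mulfK.
rewrite -[X in _ --> X]mul1r; apply: cvgMl.
apply: (@squeeze_cvgr _ _ _ _ (fun=> 1) (fun n => 1 + q ^+ n * euler_series u)).
- by near=> n; rewrite euler_le// euler_ge1// mulq_lt1.
- exact: cvg_cst.
- rewrite -[X in _ --> X]addr0; apply: cvgD; first exact: cvg_cst.
  rewrite -(mul0r (euler_series u)); apply: cvgMl.
  by apply: cvg_expr; rewrite ger0_norm ?ltW.
Unshelve. all: by end_near. Qed.

Lemma qpoch_infE u : 0 <= u < 1 -> qpoch_inf u q = (euler_series u)^-1.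
Proof. by move=> hu; apply/cvg_lim; [exact: Rhausdorff|exact: cvg_qpoch]. Qed.

(** Termwise on monomials: the power x^i turns Euler's series at a into Euler's
    series at a q^i, and [euler_mulqX] extracts the factor (a;q)_i. *)
Lemma cvg_moment a p : 0 <= a < 1 ->
  series (fun k => euler_term a k * p.[q ^+ k]) n @[n --> \oo] -->
  moment a q p * euler_series a.
Proof.
move=> ha.
have -> : series (fun k => euler_term a k * p.[q ^+ k]) =
   (fun n => \sum_(i < size p) p`_i * series (euler_term (a * q ^+ i)) n).
  apply/funext => n; rewrite /series/=; under [RHS]eq_bigr do rewrite mulr_sumr.
  rewrite exchange_big/=; apply: eq_bigr => k _; rewrite horner_coef mulr_sumr.
  apply: eq_bigr => i _; rewrite /euler_term exprMn -!exprM (mulnC k i); ring.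
rewrite /moment mulr_suml; apply: cvg_big => [|i _]; first exact: add_continuous.
rewrite -mulrA -euler_mulqX//; apply: cvgMr.
exact: is_cvg_euler (mulq_lt1 _ _).
Qed.

End Euler.

(** * Integration against the discrete measure *)

Section MuIntegral.
Local Open Scope classical_set_scope.
Variables (R : realType) (q : R) (hq : 0 < q < 1).
Implicit Types g h : R -> R.

Let D : set R := `]0, +oo[.
Let w k : R := mu_weight q (q ^+ k).

Let mD : measurable D. Proof. exact: measurable_itv. Qed.

(** The measure is a countable sum of point masses, and integration of
    nonnegative functions commutes with such sums. *)
Lemma ge0_integral_mu h : measurable_fun D h -> (forall x, 0 <= h x) ->
  cvgn (series (fun k => w k * h (q ^+ k))) ->
  (\int[mu hq]_(x in D) (h x)%:E)%E =
  (limn (series (fun k => w k * h (q ^+ k))))%:E.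
Proof.
move=> mh h0 ch.
have mEh : measurable_fun D (EFin \o h) by exact/measurable_EFinP.
rewrite /mu ge0_integral_measure_series//; last by move=> t _; rewrite lee_fin.
rewrite -EFin_lim//; congr (limn _); apply/funext => n.
rewrite /= /series/= -sumEFin; apply: eq_bigr => k _.
rewrite ge0_integral_mscale//; last by move=> t _; rewrite lee_fin.
rewrite integral_dirac//= diracE mem_set ?mul1e//.
by rewrite /D/= in_itv/= andbT exprn_gt0//; case/andP: hq.
Qed.

(** Positive and negative parts are treated by [ge0_integral_mu]; absolute
    convergence makes the difference of the two series meaningful. *)
Lemma integral_mu g : measurable_fun D g ->
  cvgn (series (fun k => w k * `|g (q ^+ k)|)) ->
  (mu hq).-integrable D (EFin \o g) /\
  \int[mu hq]_(x in D) g x = limn (series (fun k => w k * g (q ^+ k))).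
Proof.
move=> mg cg.
have w0 k : 0 <= w k by exact: mu_weight_ge0.
have cpos (h : R -> R) : (forall x, 0 <= h x <= `|g x|) ->
    cvgn (series (fun k => w k * h (q ^+ k))).
  move=> hg; apply: series_le_cvg cg => k.
  - by rewrite mulr_ge0//; case/andP: (hg (q ^+ k)).
  - by rewrite mulr_ge0.
  - by rewrite ler_wpM2l//; case/andP: (hg (q ^+ k)).
have cp : cvgn (series (fun k => w k * g^\+ (q ^+ k))).
  apply: cpos => x; rewrite funrpos_ge0/= /funrpos.
  by rewrite ge_max ler_norm normr_ge0.
have cn : cvgn (series (fun k => w k * g^\- (q ^+ k))).
  apply: cpos => x; rewrite funrneg_ge0/= /funrneg.
  by rewrite ge_max -normrN ler_norm normr_ge0.
split.
  apply/integrableP; split; first exact/measurable_EFinP.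
  rewrite (@ge0_integral_mu (fun x => `|g x|)) ?ltry//.
  exact: measurableT_comp.
rewrite /Rintegral integralE funerpos funerneg.
rewrite !ge0_integral_mu//; last 2 first.
- exact: measurable_funrneg.
- exact: measurable_funrpos.
rewrite -EFinB/= -limB//; congr (limn _).
rewrite -[X in _ + X]seriesN -seriesD; congr (series _); apply/funext => k.
by rewrite !fctE -mulrN -mulrDr -[in RHS](funrposBneg g).
Qed.

(** At x = q^k the weight is q^k (q;q)_oo / (q;q)_k, and q^k x^al is
    (q^(al + 1))^k: the series is that of [cvg_moment] with a = q^(al + 1).
    Absolute convergence holds because p is bounded on [0, 1]. *)
Lemma integral_mu_powR_horner (al : R) (p : {poly R}) : -1 < al ->
  let g := fun x : R => x `^ al * p.[x] in
  (mu hq).-integrable D (EFin \o g) /\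
  \int[mu hq]_(x in D) g x =
    qpoch_inf q q * (moment (q `^ (al + 1)) q p / qpoch_inf (q `^ (al + 1)) q).
Proof.
move=> hal g; have /andP[q0 q1] := hq.
set a := q `^ (al + 1).
have ha : 0 <= a < 1 by apply: powR_lt1; rewrite// -ltrBlDr sub0r.
have hqq : 0 <= q < 1 by rewrite q1 ltW.
have wE k : w k * g (q ^+ k) = qpoch_inf q q * (euler_term q a k * p.[q ^+ k]).
  rewrite /w /mu_weight /g -exprSr exprS qpoch_infE ?euler_mulqX//; last first.
    by have := mulq_lt1 hq k hqq.
  rewrite invfM -qpoch_infE// /euler_term.
  have -> : a ^+ k = q ^+ k * (q ^+ k) `^ al.
    rewrite -powR_mulrn ?powR_ge0// /a -powRrM mulrDl mul1r.
    rewrite powRD ?(gt_eqF q0) ?implybT// mulrC powR_mulrn ?ltW//; congr (_ * _).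
    by rewrite -[q ^+ k]powR_mulrn ?ltW// -powRrM mulrC.
  ring.
have mg : measurable_fun D g.
  apply: measurable_funM; first exact: measurable_funTS.
  exact: measurable_poly.
have e0 k : 0 <= euler_term q a k by case/andP: ha => ? _; exact: euler_term_ge0.
have c1 : cvgn (series (fun k => w k * `|g (q ^+ k)|)).
  pose C : R := \sum_(i < size p) `|p`_i|.
  have C0 : 0 <= C by rewrite sumr_ge0.
  have pC k : `|p.[q ^+ k]| <= C.
    rewrite horner_coef; apply: le_trans (ler_norm_sum _ _ _) _.
    apply: ler_sum => i _; rewrite normrM ler_piMr// ger0_norm -exprM.
      by rewrite exprn_ile1 ?(ltW q0) ?(ltW q1).
    by rewrite exprn_ge0 ?(ltW q0).
  have qi0 : 0 <= qpoch_inf q q by apply: qpoch_inf_ge0; rewrite // (ltW q0) (ltW q1).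
  apply: (@series_le_cvg _ _ (fun k => (qpoch_inf q q * C) * euler_term q a k)) => [k|k|k|].
  - by rewrite mulr_ge0// mu_weight_ge0.
  - exact: mulr_ge0 (mulr_ge0 qi0 C0) (e0 k).
  - rewrite -[X in X * _](ger0_norm (mu_weight_ge0 hq k)) -normrM wE.
    rewrite normrM ger0_norm// -mulrA ler_wpM2l// normrM ger0_norm// mulrC.
    by rewrite ler_wpM2r.
  - exact/is_cvg_seriesZ/is_cvg_euler.
have [ig ->] := integral_mu mg c1; split=> //.
have -> : (fun k => w k * g (q ^+ k)) =
    qpoch_inf q q *: (fun k => euler_term q a k * p.[q ^+ k]).
  by apply/funext => k; rewrite wE.
have /cvg_lim -> // : series (qpoch_inf q q *: (fun k => euler_term q a k * p.[q ^+ k]))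
     n @[n --> \oo] --> qpoch_inf q q * (moment a q p / qpoch_inf a q).
rewrite seriesZ (@qpoch_infE _ _ hq a)// invrK.
by apply: cvgMr; exact: cvg_moment.
Qed.

End MuIntegral.

(** * The angular variable *)

Section Angle.
Variable R : realType.
Implicit Types (x y theta c r : R).

Definition cis theta : R[i] := cos theta +i* sin theta.

Lemma cisD x y : cis (x + y) = cis x * cis y.
Proof. by rewrite /cis cosD sinD; apply/eqP; rewrite eq_complex/= !eqxx/= addrC eqxx. Qed.

Lemma cisN x : cis (- x) = conjc (cis x).
Proof. by rewrite /cis cosN sinN. Qed.

Lemma cis0 : cis 0 = 1.
Proof. by rewrite /cis cos0 sin0. Qed.

Lemma cisX x n : cis x ^+ n = cis (n%:R * x).
Proof.
elim: n => [|n IH]; first by rewrite mul0r cis0.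
by rewrite exprSr IH -cisD -natr1 mulrDl mul1r.
Qed.

Lemma cis_pi2 n : cis (n%:R * (2 * pi)) = 1.
Proof.
rewrite -cisX (_ : 2 * pi = pi *+ 2 :> R); last by rewrite mulr_natl.
by rewrite /cis cos2pi sin2pi expr1n.
Qed.

Lemma cisB_pi2 i j : cis ((i%:R - j%:R) * (2 * pi)) = 1.
Proof. by rewrite mulrBl cisD cisN !cis_pi2 mul1r rmorph1. Qed.

Lemma conj_realM r (z : R[i]) : conjc (r%:C * z) = r%:C * conjc z.
Proof. by case: z => a b; simpc. Qed.

Lemma polarE r theta : polar r theta = r%:C * cis theta.
Proof. by []. Qed.

(** The factor of [wall2] depending only on |z| = r; the truncated subtractions
    add up to |m - n|. *)
Definition radial q beta m n r : R :=
  r ^+ (m - n + (n - m)) *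
  (wallp (q `^ (`|m%:R - n%:R| + beta + 1)) q (minn m n)).[r ^+ 2].

Lemma wall2C q beta m n z1 z2 : wall2 q beta m n z1 z2 = wall2 q beta n m z2 z1 :> R[i].
Proof.
by rewrite /wall2; case: (ltngtP m n) => [_|_|->]; rewrite ?subnn ?leqnn ?(mulrC z1 z2).
Qed.

(** For n <= m this is z^(m - n) times a real function of |z|^2; the other case
    exchanges z and its conjugate, that is, the sign of the angle. *)
Lemma wall2_polar q beta m n r theta : 0 < q < 1 -> -1 < beta ->
  wall2 q beta m n (polar r theta) (conjc (polar r theta)) =
  (radial q beta m n r)%:C * cis ((m%:R - n%:R) * theta).
Proof.
move=> hq hbeta.
have key i j (t : R) : (j <= i)%N ->
    (r%:C * cis t) ^+ (i - j) * wall q (beta + i%:R - j%:R) j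
       ((r ^+ 2)%:C) =
  (radial q beta i j r)%:C * cis ((i%:R - j%:R) * t).
  move=> ji; rewrite wallE//; last first.
    by rewrite -addrA -natrB// ltr_wpDr.
  rewrite exprMn cisX natrB// mulrAC -rmorphXn -rmorphM/=; congr (_%:C * _).
  rewrite /radial (eqP ji) addn0 (minn_idPr ji) ger0_norm; last by rewrite -natrB.
  by rewrite (addrC (i%:R - j%:R)) [in RHS]addrA.
have cj (t : R) : conjc (polar r t) = r%:C * cis (- t).
  by rewrite polarE conj_realM cisN.
have nrm (t : R) : (r%:C * cis t) * (r%:C * cis (- t)) = (r ^+ 2)%:C.
  by rewrite mulrACA -cisD subrr cis0 mulr1 -rmorphM.
rewrite cj polarE; have [nm|/ltnW mn] := leqP n m.
  by rewrite /wall2 nm nrm key.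
rewrite wall2C /wall2 mn.
rewrite [X in wall _ _ _ X]mulrC nrm key//.
rewrite mulrN -mulNr opprB; congr (_%:C * _).
by rewrite /radial addnC minnC distrC.
Qed.

Lemma Rintegral_antiderivative (f F : R -> R) a b : a < b ->
  continuous f -> (forall x, is_derive x 1 F (f x)) ->
  \int[lebesgue_measure]_(x in `[a, b]%classic) f x = F b - F a.
Proof.
move=> ab cf dF.
have cF : continuous F.
  by move=> x; apply/differentiable_continuous/derivable1_diffP; case: (dF x).
rewrite /Rintegral (@continuous_FTC2 _ f F)//.
- exact/continuous_subspaceT.
- split.
  + by move=> x _; case: (dF x).
  + exact: cvg_at_right_filter (cF a).
  + exact: cvg_at_left_filter (cF b).
- by move=> x _; rewrite derive1E; case: (dF x).
Qed.

Lemma continuous_comp_mul c r (f : R -> R) : continuous f ->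
  continuous (fun t => r * f (c * t)).
Proof.
move=> cf x; apply: cvgMr.
apply: (continuous_comp _ (cf _)).
apply: cvgMr; exact: cvg_id.
Qed.

Lemma integrable_comp_mul c r (f : R -> R) : continuous f ->
  lebesgue_measure.-integrable `[0, 2 * pi]%classic (EFin \o (fun t => r * f (c * t))).
Proof.
move=> cf; apply: continuous_compact_integrable; first exact: segment_compact.
exact/continuous_subspaceT/continuous_comp_mul.
Qed.

Lemma is_derive_comp_mul (f df : R -> R) c x : (forall y, is_derive y 1 f (df y)) ->
  is_derive x 1 (fun t => f (c * t)) (c * df (c * x)).
Proof.
move=> dF; rewrite mulrC.
have d : is_derive x 1 ( *%R c) c.
  have := @is_deriveZ _ _ _ id c x 1 1 (is_derive_id _ _).
  by rewrite /GRing.scale/= mulr1.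
exact: (@is_derive1_comp _ f ( *%R c) x).
Qed.

Lemma Rintegral_cos i j :
  \int[lebesgue_measure]_(t in `[0, 2 * pi]%classic) cos ((i%:R - j%:R) * t) =
  (i == j)%:R * (2 * pi) :> R.
Proof.
have pi2 : 0 < 2 * pi :> R by rewrite mulr_gt0// pi_gt0.
have cpi := cisB_pi2 i j.
set c := i%:R - j%:R in cpi *.
have [ij|ij] := eqVneq i j.
  rewrite /c ij subrr; under eq_Rintegral do rewrite mul0r cos0.
  rewrite (@Rintegral_antiderivative (cst 1) id)//; last by move=> x; exact: cvg_cst.
  by rewrite subr0 mul1r.
have c0 : c != 0 by rewrite subr_eq0 eqr_nat.
have cf : continuous (fun t => cos (c * t)).
  have := @continuous_comp_mul c 1 _ (@continuous_cos R).
  by under [X in continuous X -> _]eq_fun do rewrite mul1r.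
have dF x : is_derive x 1 (fun t => c^-1 * sin (c * t)) (cos (c * x)).
  have d := @is_derive_comp_mul _ _ c x (@is_derive_sin R).
  have := is_deriveZ (c^-1) d.
  by rewrite /GRing.scale/= mulKf.
rewrite (Rintegral_antiderivative pi2 cf dF).
by case: cpi => _ ->; rewrite !mulr0 sin0 mulr0 subrr mul0r.
Qed.

Lemma Rintegral_sin i j :
  \int[lebesgue_measure]_(t in `[0, 2 * pi]%classic) sin ((i%:R - j%:R) * t) = 0 :> R.
Proof.
have pi2 : 0 < 2 * pi :> R by rewrite mulr_gt0// pi_gt0.
have cpi := cisB_pi2 i j.
set c := i%:R - j%:R in cpi *.
have [ij|ij] := eqVneq i j.
  rewrite /c ij subrr; under eq_Rintegral do rewrite mul0r sin0.
  by rewrite Rintegral_cst// mul0r.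
have c0 : c != 0 by rewrite subr_eq0 eqr_nat.
have cf : continuous (fun t => sin (c * t)).
  have := @continuous_comp_mul c 1 _ (@continuous_sin R).
  by under [X in continuous X -> _]eq_fun do rewrite mul1r.
have dF x : is_derive x 1 (fun t => - c^-1 * cos (c * t)) (sin (c * x)).
  have d := @is_derive_comp_mul _ _ c x (@is_derive_cos R).
  have := is_deriveZ (- c^-1) d.
  by rewrite /GRing.scale/= mulrN mulrNN mulKf.
rewrite (Rintegral_antiderivative pi2 cf dF).
by case: cpi => -> _; rewrite !mulr0 cos0 subrr.
Qed.

Lemma Re_realM r (z : R[i]) : @complex.Re R (r%:C * z) = r * complex.Re z.
Proof. by case: z => a b; simpc. Qed.

Lemma Im_realM r (z : R[i]) : @complex.Im R (r%:C * z) = r * complex.Im z.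
Proof. by case: z => a b; simpc. Qed.

(** The frequency is kept as a difference of natural numbers, so that the
    periodicity of [cis] can be used without passing to signed integers. *)
Definition fourier_mode (rho : R) i j : R -> R[i] :=
  fun t => rho%:C * cis ((i%:R - j%:R) * t).

Lemma cintegrable_fourier_mode rho i j :
  cintegrable lebesgue_measure `[0, 2 * pi]%classic (fourier_mode rho i j).
Proof.
split; rewrite /fourier_mode.
  rewrite (_ : (fun t => _) = EFin \o (fun t => rho * cos ((i%:R - j%:R) * t))); last first.
    by apply/funext => t; congr (_%:E); exact: Re_realM.
  exact: integrable_comp_mul (@continuous_cos R).
rewrite (_ : (fun t => _) = EFin \o (fun t => rho * sin ((i%:R - j%:R) * t))); last first.
  by apply/funext => t; congr (_%:E); exact: Im_realM.
exact: integrable_comp_mul (@continuous_sin R).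
Qed.

Lemma cintegral_fourier_mode rho i j :
  cintegral lebesgue_measure `[0, 2 * pi]%classic (fourier_mode rho i j) =
  ((i == j)%:R * (2 * pi) * rho)%:C.
Proof.
rewrite /cintegral /fourier_mode.
rewrite (_ : (fun t => complex.Re _) = (fun t => rho * cos ((i%:R - j%:R) * t))); last first.
  by apply/funext => t; exact: Re_realM.
rewrite (_ : (fun t => complex.Im _) = (fun t => rho * sin ((i%:R - j%:R) * t))); last first.
  by apply/funext => t; exact: Im_realM.
have int1 (f : R -> R) : continuous f ->
  lebesgue_measure.-integrable `[0, 2 * pi]%classic
     (EFin \o (fun t => f ((i%:R - j%:R) * t))).
  move=> cf; have := @integrable_comp_mul (i%:R - j%:R) 1 f cf.
  by under [X in _ \o X]eq_fun do rewrite mul1r.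
rewrite !RintegralZl//; [|exact: (int1 _ (@continuous_sin R))|exact: (int1 _ (@continuous_cos R))].
by rewrite Rintegral_cos Rintegral_sin mulr0 mulrC.
Qed.

End Angle.

(** * Orthogonality in polar coordinates *)

Section Polar.
Variables (R : realType) (q beta : R).

Lemma cintegral_real (d : measure_display) (T : measurableType d)
    (nu : {measure set T -> \bar R}) (D : set T) (F : T -> R[i]) (g : T -> R) :
  measurable D -> (forall x, D x -> F x = (g x)%:C) ->
  nu.-integrable D (EFin \o g) ->
  cintegrable nu D F /\ cintegral nu D F = (\int[nu]_(x in D) g x)%:C.
Proof.
move=> mD Fg ig.
have ReF x : x \in D -> complex.Re (F x) = g x by move=> /set_mem /Fg ->.
have ImF x : x \in D -> complex.Im (F x) = 0 by move=> /set_mem /Fg ->.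
split; first split.
- by apply: eq_integrable ig => // x xD /=; rewrite ReF.
- apply: (@eq_integrable _ _ _ _ _ mD (cst 0%E)) => [x xD /=|]; first by rewrite ImF.
  exact: integrable0.
- rewrite /cintegral (@eq_Rintegral _ _ _ nu D g _ ReF) (@eq_Rintegral _ _ _ nu D (cst 0) _ ImF).
  by rewrite Rintegral_cst// mul0r.
Qed.

Lemma angular_mean_fourier_mode (F : R[i] -> R[i]) rho i j r :
  (forall t, F (polar r t) = fourier_mode rho i j t) ->
  angular_mean F r = ((i == j)%:R * rho)%:C.
Proof.
move=> Fr; rewrite /angular_mean (_ : (fun t => _) = fourier_mode rho i j); last first.
  exact/funext.
rewrite cintegral_fourier_mode -rmorphM /=; congr (_%:C).
have : (2 * pi : R) != 0 by rewrite mulf_neq0// gt_eqF ?pi_gt0.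
by move=> h; rewrite mulrAC mulrC mulfK.
Qed.

(** If m - n = s - t the two radial factors carry the same power of r, and their
    product contributes x^|m - n| at r^2 = x, which together with x^beta gives
    the exponent of the weight for which both Wall polynomials are orthogonal. *)
Lemma radialM_sqrt (m n s t : nat) x : 0 < x -> (m + t = s + n)%N ->
  radial q beta m n (Num.sqrt x) * radial q beta s t (Num.sqrt x) * x `^ beta =
  x `^ (`|m%:R - n%:R| + beta) *
  (wallp (q `^ (`|m%:R - n%:R| + beta + 1)) q (minn m n) *
   wallp (q `^ (`|m%:R - n%:R| + beta + 1)) q (minn s t)).[x].
Proof.
move=> x0 e.
(* Both index pairs give the same difference, hence the same Wall parameter. *)
have de : m%:R - n%:R = s%:R - t%:R :> R.
  by apply/eqP; rewrite subr_eq addrAC eq_sym subr_eq -!natrD e.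
have ne : (s - t + (t - s) = m - n + (n - m))%N by lia.
rewrite /radial -de ne hornerM sqr_sqrtr ?ltW//.
have -> : `|m%:R - n%:R| = (m - n + (n - m))%:R :> R.
  have [h|/ltnW h] := leqP n m.
    by rewrite -natrB// normr_nat; congr (_%:R); lia.
  by rewrite distrC -natrB// normr_nat; congr (_%:R); lia.
rewrite (@powRD _ x); last by rewrite (gt_eqF x0) implybT.
rewrite powR_mulrn ?(ltW x0)//.
set k := (m - n + _)%N.
have -> : x ^+ k = Num.sqrt x ^+ k * Num.sqrt x ^+ k by rewrite -exprMn -expr2 sqr_sqrtr ?ltW.
by rewrite mulrACA [RHS]mulrAC.
Qed.

End Polar.

Theorem theorem5p5 (R : realType) (q : R) (hq : 0 < q < 1)
    (beta : R) (hbeta : -1 < beta) (m n s t : nat) :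
  let F := fun z : R[i] =>
    wall2 q beta m n z (conjc z) * conjc (wall2 q beta s t z (conjc z)) in
  polar_integrable hq beta F /\
  polar_integral hq beta F =
    (zeta q (minn m n) (`|m%:R - n%:R| + beta)
       * (m == s)%:R * (n == t)%:R)%:C.
Proof.
move=> F.
pose rho r := radial q beta m n r * radial q beta s t r.
have FE r theta : F (polar r theta) = fourier_mode (rho r) (m + t) (s + n) theta.
  rewrite /F !wall2_polar// /fourier_mode conj_realM mulrACA -rmorphM -cisN -cisD.
  by congr (_ * cis _); rewrite !natrD; ring.
have meanE r : angular_mean F r = ((m + t == s + n)%N%:R * rho r)%:C.
  by apply: angular_mean_fourier_mode => theta; exact: FE.
pose al := `|m%:R - n%:R| + beta.
have hal : -1 < al by rewrite /al ltr_wpDl.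
pose A := q `^ (al + 1).
pose p := (m + t == s + n)%N%:R *: (wallp A q (minn m n) * wallp A q (minn s t)).
have [ig intg] := integral_mu_powR_horner hq p hal.
have intE x : `]0, +oo[%classic x ->
    angular_mean F (Num.sqrt x) * (x `^ beta)%:C = (x `^ al * p.[x])%:C.
  rewrite /= in_itv/= andbT => x0; rewrite meanE -rmorphM/= hornerZ.
  congr (_%:C); have [e|_] := eqVneq (m + t)%N (s + n)%N.
    by rewrite !mul1r; exact: radialM_sqrt.
  by rewrite !mul0r mulr0.
have [ci cE] := cintegral_real (measurable_itv _) intE ig.
split; last first.
  rewrite /polar_integral cE intg; congr (_%:C).
  rewrite linearZ/= moment_wallpM//; last first.
    by apply: powR_lt1; rewrite// -ltrBlDr sub0r.
  rewrite /zeta -/A -/al powRrM powR_mulrn ?powR_ge0// -/A.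
  rewrite -!mulrA -natrM mulnb.
  have -> : (m == s) && (n == t) = (m + t == s + n)%N && (minn m n == minn s t).
    by apply/idP/idP => h; lia.
  rewrite -mulnb natrM /GRing.scale/= invfM; ring.
split=> // x x0.
rewrite (_ : (fun theta => _) = fourier_mode (rho (Num.sqrt x)) (m + t) (s + n)).
  exact: cintegrable_fourier_mode.
by apply/funext => theta; exact: FE.
Qed.
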